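(* Let $\mathcal{G}_{\mathrm{bip}}$ be the class of all one-directional bipartite influence graphs $G=(L,R,E,p)$. Then, for the influence maximization problem in the independent cascade model with full-adoption feedback, $$\sup_{G\in\mathcal{G}_{\mathrm{bip}},\,k\ge 1}\frac{\mathrm{OPT}_A(G,k)}{\mathrm{OPT}_N(G,k)}=\frac{e}{e-1}.$$
   Context: A one-directional bipartite influence graph $G=(L,R,E,p)$ has node set $V=L\cup R$ ($L,R$ disjoint), edge set $E\subseteq L\times R$ (every edge points from a node of $L$ to a node of $R$), and a probability $p_{uv}\in[0,1]$ on each edge. Independent cascade (IC) model: a live-edge graph (realization) $\phi$ is a random subgraph in which each edge $(u,v)$ is present (''live'') independently with probability $p_{uv}$; $\mathcal{P}$ denotes this distribution. For $S\subseteq V$, $\Gamma(S,\phi)$ is the set of nodes reachable from $S$ in $\phi$, and $\sigma(S)=\mathbb{E}_{\Phi\sim\mathcal{P}}[|\Gamma(S,\Phi)|]$. Full-adoption feedback: when a node $u$ is selected as a seed, one observes the live/blocked status of all out-going edges of every node reachable from $u$ in the realization. A partial realization records the seeds selected so far with their observed feedback. An adaptive policy $\pi$ maps partial realizations to the next node to select; $V(\pi,\phi)$ is the seed set it selects under realization $\phi$, and $\sigma(\pi)=\mathbb{E}_{\Phi\sim\mathcal{P}}[|\Gamma(V(\pi,\Phi),\Phi)|]$. $\Pi(k)$ is the set of policies with $|V(\pi,\phi)|\le k$ for every realization $\phi$. $\mathrm{OPT}_N(G,k)=\max_{S\subseteq V,|S|\le k}\sigma(S)$ and $\mathrm{OPT}_A(G,k)=\sup_{\pi\in\Pi(k)}\sigma(\pi)$.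 *)

(* Defs.v *)
From HB Require Import structures.
From mathcomp Require Import all_boot all_order all_algebra.
From mathcomp Require Import boolp classical_sets reals.
From mathcomp Require Import sequences.
Set Implicit Arguments. Unset Strict Implicit. Unset Printing Implicit Defensive.
Import Order.TTheory GRing.Theory Num.Theory.
Local Open Scope ring_scope.

(* A one-directional bipartite influence graph G = (L, Rt, E, p):
   node type  V = L + Rt,  edge set E : {set L * Rt} (edges point L -> Rt),
   probability p e on each edge. *)
Section IC.
Variables (R : realType) (L Rt : finType) (E : {set L * Rt}) (p : L * Rt -> R).

Definition node := (L + Rt)%type.

Definition realization (phi : {set L * Rt}) : bool := phi \subset E.

Definition prob_real (phi : {set L * Rt}) : R :=
  \prod_(e in E) (if e \in phi then p e else 1 - p e).

Definition live (phi : {set L * Rt}) : rel node :=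
  fun x y => match x, y with inl u, inr v => (u, v) \in phi | _, _ => false end.

Definition reach (S : {set node}) (phi : {set L * Rt}) : {set node} :=
  [set y | [exists x in S, connect (live phi) x y]].

Definition sigmaN (S : {set node}) : R :=
  \sum_(phi | realization phi) prob_real phi * (#|reach S phi|)%:R.

(* Full-adoption feedback of seed u under phi: the observed edges (all
   out-going edges of every node reachable from u) and those among them
   which are live. *)
Definition feedback (u : node) (phi : {set L * Rt})
  : {set L * Rt} * {set L * Rt} :=
  let D := [set e in E | inl e.1 \in reach [set u] phi] in (D, D :&: phi).

(* A partial realization: the seeds selected so far (in order), each with
   its observed feedback. *)
Definition partial_real := seq (node * ({set L * Rt} * {set L * Rt})).

Definition policy := partial_real -> option node.

Fixpoint run (pi : policy) (phi : {set L * Rt}) (n : nat) : partial_real :=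
  match n with
  | 0 => [::]
  | n.+1 => let h := run pi phi n in
            match pi h with
            | Some u => rcons h (u, feedback u phi)
            | None => h
            end
  end.

Definition seeds (pi : policy) (phi : {set L * Rt}) : {set node} :=
  [set x | `[< exists n, x \in [seq t.1 | t <- run pi phi n] >]].

Definition sigmaA (pi : policy) : R :=
  \sum_(phi | realization phi) prob_real phi * (#|reach (seeds pi phi) phi|)%:R.

Definition policies_k (k : nat) : set policy :=
  [set pi | forall phi, realization phi -> (#|seeds pi phi| <= k)%N].

Definition OPT_N (k : nat) : R :=
  \big[Num.max/0]_(S : {set node} | (#|S| <= k)%N) sigmaN S.

Definition OPT_A (k : nat) : R :=
  sup [set sigmaA pi | pi in policies_k k].

End IC.

Definition edge_probs (R : realType) (L Rt : finType) (E : {set L * Rt})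
  (p : L * Rt -> R) : Prop := forall e, e \in E -> 0 <= p e <= 1.

(* Main.v *)
(* Upper bound.  Let q_x be the probability that the policy selects x.  In a
   one-directional bipartite graph the feedback of a seed concerns its own
   out-edges only, so selecting x is independent of the out-edges of x, and a
   node y is reached with probability at most min(1, sum_x q_x a_xy), a_xy being
   the probability that x activates y.  Seeding every x independently with
   probability q_x reaches y with probability
   1 - prod_x (1 - q_x a_xy) >= (1 - 1/e) min(1, sum_x q_x a_xy), and pipage
   rounding turns the fractional vector q, whose sum is at most k, into a set of
   at most k seeds without decreasing the expected spread.

   Tightness.  Take n^2 groups of n^2 targets, a source for every choice of one
   target per group (each in n^3 copies), all edge probabilities 1/n, and
   k = n^3.  Aiming in every group at the first target not yet hit, an adaptive
   policy collects min(Bin(n^3, 1/n), n^2) targets per group, which is n^2 - O(n)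
   in expectation, whereas k fixed sources aim n times at a target on average,
   and so reach it with probability at most 1 - (1 - 1/n)^n by convexity. *)
Require Import Defs.
From HB Require Import structures.
From mathcomp Require Import all_boot all_order all_algebra.
From mathcomp Require Import boolp classical_sets reals.
From mathcomp Require Import sequences exp.
From mathcomp Require Import ring lra.
Set Implicit Arguments. Unset Strict Implicit. Unset Printing Implicit Defensive.
Import Order.TTheory GRing.Theory Num.Theory.
Local Open Scope ring_scope.

(** * Expectations under a product measure on subsets *)

Section BernoulliSet.
Variables (R : numDomainType) (T : finType) (w : T -> R).
Implicit Types (f g : {set T} -> R) (A : {set T}).

Definition bern A : R := \prod_e (if e \in A then w e else 1 - w e).
Definition expect f : R := \sum_A bern A * f A.

Lemma eq_expect f g : f =1 g -> expect f = expect g.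
Proof. by move=> fg; apply: eq_bigr => A _; rewrite fg. Qed.

Lemma expectD f g : expect (fun A => f A + g A) = expect f + expect g.
Proof. by rewrite -big_split; apply: eq_bigr => A _; rewrite mulrDr. Qed.

Lemma expectZ c f : expect (fun A => c * f A) = c * expect f.
Proof. by rewrite mulr_sumr; apply: eq_bigr => A _; rewrite mulrCA. Qed.

Lemma expect_sum (I : finType) (F : I -> {set T} -> R) :
  expect (fun A => \sum_i F i A) = \sum_i expect (F i).
Proof.
rewrite exchange_big; apply: eq_bigr => A _ /=; exact: mulr_sumr.
Qed.

Lemma expect_cst c : expect (fun=> c) = c.
Proof.
rewrite /expect -mulr_suml -[RHS]mul1r; congr (_ * _).
(* Expanding the product of the factors [w e + (1 - w e)], all equal to 1, yields the total mass. *)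
have := @bigA_distr R 0 1 *%R +%R T w (fun e => 1 - w e).
rewrite big1 => [->|e _]; last by rewrite /= addrC subrK.
by apply: eq_bigl => A; rewrite inE.
Qed.

Lemma sum_set_split e f :
  \sum_A f A = \sum_(A : {set T} | e \notin A) (f (e |: A) + f A).
Proof.
rewrite (bigID (fun A => e \in A)) big_split /=; congr (_ + _).
rewrite (reindex_onto (fun A => e |: A) (fun A => A :\ e)) /=.
  apply: eq_bigl => A; rewrite setU11 /=.
  apply/eqP/idP => [<-|eA]; first by rewrite !inE eqxx.
  by rewrite setU1K.
by move=> A eA; rewrite finset.setD1K.
Qed.

Lemma bern_setU1 e A : e \notin A ->
  bern (e |: A) = w e * \prod_(i | i != e) (if i \in A then w i else 1 - w i).
Proof.
move=> eA; rewrite /bern (bigD1 e) //= setU11; congr (_ * _).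
by apply: eq_bigr => i ie; rewrite !inE (negPf ie).
Qed.

Lemma bern_notin e A : e \notin A ->
  bern A = (1 - w e) * \prod_(i | i != e) (if i \in A then w i else 1 - w i).
Proof. by move=> eA; rewrite /bern (bigD1 e) //= (negPf eA). Qed.

(** The hypothesis says that [f] ignores whether [e] is present, hence is independent of that event.
    Pairing each [A] without [e] with [e |: A] makes the common factor appear. *)
Lemma expect_mem e f : (forall A, f (e |: A) = f (A :\ e)) ->
  expect (fun A => f A * (e \in A)%:R) = w e * expect f.
Proof.
move=> fe; rewrite /expect !(sum_set_split e) mulr_sumr.
apply: eq_bigr => A eA; rewrite bern_setU1 // (bern_notin eA) setU11 (negPf eA).
rewrite mulr1 !mulr0 addr0 fe (_ : A :\ e = A); last first.
  by apply/finset.setDidPl; rewrite disjoint_sym disjoints1.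
set P := \prod_(_ | _) _; rewrite -mulrDl -mulrDl addrCA subrr addr0 mul1r.
by rewrite mulrA.
Qed.

Hypothesis w01 : forall e, 0 <= w e <= 1.

Lemma bern_ge0 A : 0 <= bern A.
Proof.
by apply: prodr_ge0 => e _; have /andP[? ?] := w01 e; case: ifP; rewrite ?subr_ge0.
Qed.

(** Asking for the inequality only on the support allows the seed budget, known only for
    realizations, to be integrated. *)
Lemma ler_expect f g : (forall A, bern A != 0 -> f A <= g A) ->
  expect f <= expect g.
Proof.
move=> fg; apply: ler_sum => A _; have [->|nz] := eqVneq (bern A) 0.
  by rewrite !mul0r.
by apply: ler_wpM2l; rewrite ?bern_ge0 ?fg.
Qed.

End BernoulliSet.

(** * One-step reachability and independent activations *)

Section BipartiteCascade.
Variables (R : realType) (L Rt : finType) (E : {set L * Rt}) (p : L * Rt -> R).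
Implicit Types (phi : {set L * Rt}) (x y : (L + Rt)%type)
  (S : {set (L + Rt)%type}).

(** Weight 0 off [E] turns the law on subgraphs of [E] into a product measure on all sets of
    pairs. *)
Definition edge_weight (e : L * Rt) : R := if e \in E then p e else 0.

Lemma bern_realization phi :
  bern edge_weight phi = if realization E phi then prob_real E p phi else 0.
Proof.
rewrite /realization /bern; case: ifPn => [/fintype.subsetP phiE|/subsetPn[e ephi eE]].
  rewrite /prob_real [RHS]big_mkcond; apply: eq_bigr => e _.
  rewrite /edge_weight; case: ifPn => [/phiE->//|_].
  by case: ifP => //; rewrite subr0.
by rewrite (bigD1 e) //= ephi /edge_weight (negPf eE) mul0r.
Qed.

Lemma sum_realization (f : {set L * Rt} -> R) :
  \sum_(phi | realization E phi) prob_real E p phi * f phi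
  = expect edge_weight f.
Proof.
rewrite big_mkcond; apply: eq_bigr => phi _; rewrite bern_realization.
by case: ifP; rewrite ?mul0r.
Qed.

Definition hit x y phi := (x == y) || live phi x y.

Lemma connect_live phi x y : connect (live phi) x y = hit x y phi.
Proof.
apply/idP/idP => [/connectP[[|a s]]|/orP[/eqP->|]]; last 2 first.
- exact: connect0.
- exact: connect1.
- by move=> _ ->; rewrite /hit eqxx.
- case: x a => [u|v] [u'|v'] //= /andP[uv]; by case: s => [_ ->|[a|a] s].
Qed.

Lemma mem_reach S phi y : (y \in reach S phi) = [exists x in S, hit x y phi].
Proof.
by rewrite inE; apply: eq_existsb => x; rewrite connect_live.
Qed.

Definition activation x y : R :=
  match x, y with
  | inl u, inr v => edge_weight (u, v)
  | _, _ => (x == y)%:R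
  end.

Lemma expect_hit x y (f : {set L * Rt} -> R) :
  (forall e phi, inl e.1 = x -> f (e |: phi) = f (phi :\ e)) ->
  expect edge_weight (fun phi => f phi * (hit x y phi)%:R)
  = activation x y * expect edge_weight f.
Proof.
move=> fx; case: x y fx => [u|v] [u'|v'] fx; rewrite /hit /activation;
  try by rewrite -expectZ; apply: eq_expect => phi; rewrite orbF mulrC.
by rewrite -expect_mem // => phi; apply: fx.
Qed.

(** Distinct seeds reach [y] through distinct edges, so these events are independent; the factors
    are split off one seed at a time. *)
Lemma expect_not_reach S y :
  expect edge_weight (fun phi => (y \notin reach S phi)%:R)
  = \prod_(x in S) (1 - activation x y).
Proof.
transitivity (expect edge_weight
   (fun phi => \prod_(x <- enum S) (1 - (hit x y phi)%:R))).
  apply: eq_expect => phi; rewrite mem_reach big_enum /=.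
  case: existsP => [[x /andP[xS hx]]|nh].
    by rewrite (bigD1 x) //= hx subrr mul0r.
  rewrite big1 // => x xS; case: (boolP (hit x y phi)) => [hx|]; last by rewrite subr0.
  by case: nh; exists x; rewrite xS.
rewrite -[RHS]big_enum /=; elim: (enum S) (enum_uniq S) => [_|x s IHs /= /andP[xs us]].
  by rewrite big_nil; under eq_expect do rewrite big_nil; rewrite expect_cst.
rewrite big_cons -IHs // mulrBl mul1r -expect_hit.
  rewrite -[X in _ = _ - X]mul1r -mulNr -expectZ -expectD.
  by apply: eq_expect => phi; rewrite big_cons; ring.
move=> {IHs} e phi ex; apply: eq_big_seq => x' x's; congr (1 - _%:R).
rewrite /hit; congr (nat_of_bool (_ || _)).
case: x' y x's => [u'|v'] [u|v] //= u's; rewrite !inE.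
suff -> : ((u', v) == e) = false by [].
apply/eqP => ue; move: xs; rewrite -ex -ue /=; by rewrite u's.
Qed.

End BipartiteCascade.

(** * Adaptive runs and the marginal probabilities of their seeds *)

Section Seeds.
Variables (R : realType) (L Rt : finType) (E : {set L * Rt}) (p : L * Rt -> R).
Implicit Types (phi : {set L * Rt}) (x y : (L + Rt)%type) (pi : policy L Rt).

Lemma mem_seeds pi phi x :
  reflect (exists n, x \in [seq t.1 | t <- run E pi phi n])
          (x \in seeds E pi phi).
Proof. by rewrite inE; apply: asboolP. Qed.

(* All out-neighbours are sinks, so a seed reveals its own out-edges only. *)
Lemma feedbackE x phi :
  let D := [set e in E | inl e.1 == x] in feedback E x phi = (D, D :&: phi).
Proof.
rewrite /feedback /=.
suff -> : [set e in E | inl e.1 \in reach [set x] phi]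
  = [set e in E | inl e.1 == x] by [].
apply/setP => e; rewrite [LHS]inE [RHS]inE mem_reach; congr (_ && _).
apply/existsP/eqP => [[x' /andP[/set1P->]]|<-].
  by rewrite /hit; case: x => [u|v]; rewrite ?orbF => /eqP.
by exists (inl e.1); rewrite set11 /hit eqxx.
Qed.

(** The realizations can differ only in out-edges of [u], and feedback shows none of these before
    [u] is selected. So the runs coincide until both select [u] at the same step. *)
Lemma run_coupling pi phi phi' u n :
    (forall e, e.1 != u -> (e \in phi) = (e \in phi')) ->
  run E pi phi n = run E pi phi' n \/
  inl u \in [seq t.1 | t <- run E pi phi n] /\
  inl u \in [seq t.1 | t <- run E pi phi' n].
Proof.
move=> eq_phi; elim: n => [|n [eq_run|[hu hu']]] /=; first by left.
  rewrite -eq_run; case: (pi _) => [x|]; last by left.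
  have [->|xu] := eqVneq x (inl u).
    by right; rewrite !map_rcons !mem_rcons !inE eqxx.
  left; rewrite !feedbackE; congr (rcons _ (_, (_, _))).
  apply/setP => e; rewrite !finset.in_setI; case: (boolP (e \in _)) => //=.
  rewrite inE => /andP[_ /eqP ex]; apply: eq_phi.
  by apply: contra_neq xu => <-.
right; split; case: (pi _) => [x|] //;
  by rewrite map_rcons mem_rcons inE ?hu ?hu' orbT.
Qed.

Lemma seeds_coupling pi phi phi' u :
    (forall e, e.1 != u -> (e \in phi) = (e \in phi')) ->
  (inl u \in seeds E pi phi) = (inl u \in seeds E pi phi').
Proof.
move=> eq_phi; apply/mem_seeds/mem_seeds => -[n un]; exists n;
  by have [eqr|[//]] := run_coupling pi n eq_phi; rewrite ?eqr -?eqr in un *.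
Qed.

Lemma expect_card (F : {set L * Rt} -> {set (L + Rt)%type}) :
  expect (edge_weight E p) (fun phi => #|F phi|%:R)
  = \sum_x expect (edge_weight E p) (fun phi => (x \in F phi)%:R).
Proof.
rewrite -expect_sum; apply: eq_expect => phi.
by rewrite -sum1_card natr_sum [LHS]big_mkcond; apply: eq_bigr => x _; case: ifP.
Qed.

Lemma sigmaAE pi : sigmaA E p pi
  = \sum_y expect (edge_weight E p)
             (fun phi => (y \in reach (seeds E pi phi) phi)%:R).
Proof. by rewrite /sigmaA sum_realization expect_card. Qed.

Lemma sigmaNE S :
  sigmaN E p S = \sum_y (1 - \prod_(x in S) (1 - activation E p x y)).
Proof.
rewrite /sigmaN sum_realization expect_card; apply: eq_bigr => y _.
rewrite -expect_not_reach -[X in _ = X - _](expect_cst (edge_weight E p)).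
rewrite -[X in _ = _ - X]mul1r -mulNr -expectZ -expectD.
by apply: eq_expect => phi; case: (_ \in _); rewrite ?mulr0 ?subr0 ?mulr1 ?subrr ?addr0.
Qed.

Hypothesis pE : edge_probs E p.

Lemma edge_weight01 e : 0 <= edge_weight E p e <= 1.
Proof. by rewrite /edge_weight; case: ifP => [/pE//|_]; rewrite lexx ler01. Qed.

Lemma activation01 x y : 0 <= activation E p x y <= 1.
Proof.
case: x y => [u|v] [u'|v']; rewrite /activation ?edge_weight01 //;
  by rewrite ler0n lern1 leq_b1.
Qed.

Definition seed_prob pi x : R :=
  expect (edge_weight E p) (fun phi => (x \in seeds E pi phi)%:R).

Lemma seed_prob01 pi x : 0 <= seed_prob pi x <= 1.
Proof.
apply/andP; split.
  rewrite -[leLHS](expect_cst (edge_weight E p)); apply: ler_expect => [e|phi _].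
    exact: edge_weight01.
  exact: ler0n.
rewrite -[leRHS](expect_cst (edge_weight E p)); apply: ler_expect => [e|phi _].
  exact: edge_weight01.
by rewrite lern1 leq_b1.
Qed.

Lemma sum_seed_prob_le pi k : policies_k E k pi ->
  \sum_x seed_prob pi x <= k%:R.
Proof.
move=> pik; rewrite /seed_prob -expect_card -[leRHS](expect_cst (edge_weight E p)).
apply: ler_expect => [|phi]; first exact: edge_weight01.
rewrite bern_realization ler_nat; case: ifP => [phiE _|_ /eqP//].
exact: pik.
Qed.

(* Whether [u] becomes a seed is independent of the out-edges of [u]. *)
Lemma sigmaA_le pi :
  sigmaA E p pi
  <= \sum_y Num.min 1 (\sum_x seed_prob pi x * activation E p x y).
Proof.
rewrite sigmaAE; apply: ler_sum => y _; rewrite le_min; apply/andP; split.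
  rewrite -[leRHS](expect_cst (edge_weight E p)); apply: ler_expect => [|phi _].
    exact: edge_weight01.
  by rewrite lern1 leq_b1.
have -> : \sum_x seed_prob pi x * activation E p x y
  = expect (edge_weight E p) (fun phi =>
      \sum_x (x \in seeds E pi phi)%:R * (hit x y phi)%:R).
  rewrite expect_sum; apply: eq_bigr => x _; rewrite expect_hit 1?mulrC //.
  move=> e phi ex; congr (_%:R); congr nat_of_bool; rewrite -ex.
  apply: seeds_coupling => e' ee'; rewrite !inE.
  by have [eqe|] := eqVneq e' e; [rewrite eqe eqxx in ee' | ].
apply: ler_expect => [|phi _]; first exact: edge_weight01.
rewrite mem_reach; case: existsP => [[x /andP[xS hx]]|_].
  rewrite (bigD1 x) //= xS hx mulr1 lerDl.
  by apply: sumr_ge0 => x' _; rewrite mulr_ge0 ?ler0n.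
by apply: sumr_ge0 => x' _; rewrite mulr_ge0 ?ler0n.
Qed.

End Seeds.

(** * Pipage rounding *)

Section Rounding.
Variables (R : realFieldType) (V W : finType) (a : V -> W -> R).
Hypothesis a01 : forall x y, 0 <= a x y <= 1.
Implicit Types (q : V -> R) (A : {set V}).

(** The multilinear extension of the spread: its expected value when every [x] is seeded
    independently with probability [q x]. *)
Definition coverage q : R := \sum_y (1 - \prod_x (1 - q x * a x y)).

Definition unit_valued q := forall x, 0 <= q x <= 1.

Definition transfer q i j t : V -> R :=
  fun x => if x == i then q i + t else if x == j then q j - t else q x.

Definition fractional q : {set V} := [set x | 0 < q x < 1].

Lemma miss01 q x y : unit_valued q -> 0 <= 1 - q x * a x y <= 1.
Proof.
move=> /(_ x) /andP[q0 q1]; have /andP[a0 a1] := a01 x y.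
by rewrite subr_ge0 mulr_ile1 //= gerBl mulr_ge0.
Qed.

Lemma le_coverage q q' : unit_valued q -> unit_valued q' ->
  (forall x, q x <= q' x) -> coverage q <= coverage q'.
Proof.
move=> q01 q'01 qq'; apply: ler_sum => y _; rewrite lerD2l lerN2.
apply: ler_prod => x _; have /andP[-> _] := miss01 x y q'01.
by rewrite lerD2l lerN2 ler_wpM2r ?qq' //; case/andP: (a01 x y).
Qed.

Lemma sum_transfer q i j t : i != j -> \sum_x transfer q i j t x = \sum_x q x.
Proof.
move=> ij; rewrite (bigD1 i) // (bigD1 j) 1?eq_sym //= [RHS](bigD1 i) //.
rewrite [in RHS](bigD1 j) 1?eq_sym //= /transfer eqxx eq_sym (negPf ij) eqxx.
rewrite (eq_bigr q); first by ring.
by move=> x /andP[/negPf-> /negPf->].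
Qed.

(* Along the direction [e_i - e_j] the coverage is a convex quadratic
   polynomial, so it lies above its tangent at [0]. *)
Lemma coverage_transfer q i j : unit_valued q -> i != j ->
  exists d, forall t, coverage q + t * d <= coverage (transfer q i j t).
Proof.
move=> q01 ij.
pose P y := \prod_(x | (x != i) && (x != j)) (1 - q x * a x y).
exists (\sum_y P y * ((1 - q j * a j y) * a i y - (1 - q i * a i y) * a j y)).
move=> t; rewrite /coverage mulr_sumr -big_split /=; apply: ler_sum => y _.
rewrite (bigD1 i) // (bigD1 j) 1?eq_sym //= [in leRHS](bigD1 i) //.
rewrite [in leRHS](bigD1 j) 1?eq_sym //= -/(P y).
rewrite {1 2}/transfer !eqxx [j == i]eq_sym (negPf ij).
rewrite [in leRHS](eq_bigr (fun x => 1 - q x * a x y)) -/(P y); last first.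
  by move=> x /andP[xi xj]; rewrite /transfer (negPf xi) (negPf xj).
have P0 : 0 <= P y by apply: prodr_ge0 => x _; case/andP: (miss01 x y q01).
have : 0 <= t ^+ 2 * (a i y * a j y * P y).
  by rewrite mulr_ge0 ?sqr_ge0 // !mulr_ge0 //;
    [case/andP: (a01 i y) | case/andP: (a01 j y)].
rewrite -subr_ge0 => h; rewrite -subr_ge0; apply: le_trans h _.
by rewrite le_eqVlt; apply/orP; left; apply/eqP; ring.
Qed.

Lemma transferC q i j t : i != j -> transfer q i j t =1 transfer q j i (- t).
Proof.
move=> ij x; rewrite /transfer opprK; have [->|//] := eqVneq x i.
by rewrite (negPf ij).
Qed.

Lemma eq_coverage q q' : q =1 q' -> coverage q = coverage q'.
Proof.
move=> qq'; apply: eq_bigr => y _; congr (_ - _).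
by apply: eq_bigr => x _; rewrite qq'.
Qed.

Lemma rounding_step q : unit_valued q -> (1 < #|fractional q|)%N ->
  exists q', [/\ unit_valued q', \sum_x q' x = \sum_x q x,
    (#|fractional q'| < #|fractional q|)%N & coverage q <= coverage q'].
Proof.
move=> q01 /card_gt1P[i [j [fi fj ij]]].
(* Up to swapping [i] and [j] the tangent has nonnegative slope, so shifting mass towards [i] never
   loses coverage. *)
have {i j fi fj ij}[i [j [ij fi fj up]]] : exists i j, [/\ i != j,
    i \in fractional q, j \in fractional q &
    forall t, 0 <= t -> coverage q <= coverage (transfer q i j t)].
  have [d hd] := coverage_transfer q01 ij; have [d0|d0] := leP 0 d.
    exists i, j; split => // t t0; apply: le_trans (hd t).
    by rewrite lerDl mulr_ge0.
  exists j, i; split; rewrite 1?eq_sym // => t t0.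
  rewrite (eq_coverage (transferC _ _ _)) 1?eq_sym //.
  apply: le_trans (hd (- t)); rewrite lerDl mulNr oppr_ge0.
  by rewrite mulr_ge0_le0 // ltW.
move: (fi) (fj); rewrite !inE => /andP[qi0 qi1] /andP[qj0 qj1].
(* The largest shift that stays in the unit cube: it makes coordinate [i] equal to 1 or coordinate
   [j] equal to 0. *)
pose t := Num.min (1 - q i) (q j).
have t0 : 0 <= t by rewrite /t le_min subr_ge0 !ltW.
have ti : t <= 1 - q i by rewrite /t ge_min lexx.
have tj : t <= q j by rewrite /t ge_min lexx orbT.
exists (transfer q i j t); split; [|exact: sum_transfer| |exact: up].
  move=> x; rewrite /transfer; case: eqP => _; last case: eqP => _ //; lra.
apply: proper_card; apply/properP; split.
  apply/fintype.subsetP => x; rewrite inE /transfer.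
  case: eqP => [->//|_]; case: eqP => [->//|_]; by rewrite inE.
have [e|e] : t = 1 - q i \/ t = q j.
  by rewrite /t; case: leP => _; [left|right].
  by exists i => //; rewrite inE /transfer eqxx e addrCA subrr addr0 ltxx andbF.
exists j => //; rewrite inE /transfer eqxx eq_sym (negPf ij) e subrr ltxx.
by [].
Qed.

(** Rounding every nonzero coordinate up adds less than 1 to the sum, as at most one coordinate is
    fractional. The support thus has fewer than [k + 1] elements. *)
Lemma rounding_end q k : unit_valued q -> (#|fractional q| <= 1)%N ->
  \sum_x q x <= k%:R ->
  exists A, (#|A| <= k)%N /\ coverage q <= coverage (fun x => (x \in A)%:R).
Proof.
move=> q01 f1 qk; exists [set x | q x != 0]; split; last first.
  apply: le_coverage => // x; first by case: (_ \in _); rewrite ?lexx ?ler01.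
  by rewrite inE; have [->|_] := eqVneq (q x) 0; rewrite //; case/andP: (q01 x).
rewrite -ltnS -(ltr_nat R) -addn1 natrD.
apply: lt_le_trans (_ : \sum_x q x + 1 <= _); last by rewrite lerD2r.
rewrite -ltrBlDl -sum1_card natr_sum big_mkcond -sumrB /=.
have gap x : (if x \in [set x | q x != 0] then 1 else 0) - q x
    = if x \in fractional q then 1 - q x else 0.
  have /andP[q0 q1] := q01 x; rewrite !inE !lt_neqAle q0 q1 !andbT eq_sym.
  have [->|nz] := eqVneq (q x) 0; first by rewrite subrr.
  by have [->|//] := eqVneq (q x) 1; rewrite subrr.
under eq_bigr do rewrite gap.
rewrite -big_mkcond /=; have [->|[x xf]] := set_0Vmem (fractional q).
  by rewrite big_set0 ltr01.
have -> : fractional q = [set x].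
  by apply/esym/eqP; rewrite eqEcard finset.sub1set xf cards1.
by rewrite big_set1 gtrBl; move: xf; rewrite inE => /andP[].
Qed.

Lemma pipage_rounding q k : unit_valued q -> \sum_x q x <= k%:R ->
  exists A, (#|A| <= k)%N /\ coverage q <= coverage (fun x => (x \in A)%:R).
Proof.
have [n] := ubnP #|fractional q|; elim: n q => // n IHn q; rewrite ltnS => fn q01 qk.
have [f1|f1] := leqP #|fractional q| 1; first exact: rounding_end.
have [q' [q'01 sq' fq' qq']] := rounding_step q01 f1.
have [|//||A [Ak q'A]] := IHn q'; first exact: leq_trans fq' fn.
  by rewrite sq'.
by exists A; split => //; apply: le_trans q'A.
Qed.

End Rounding.

(** * The correlation gap 1 - 1/e *)

Section CorrelationGap.
Variable R : realType.

(* Weighted sum of the tangents [1 + z <= e^z] and [z <= e^(z-1)], with weights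
   [1 - z] and [z]. *)
Lemma expRN_chord (z : R) : 0 <= z <= 1 ->
  expR (- z) <= 1 - (1 - expR (- 1)) * z.
Proof.
move=> /andP[z0 z1]; rewrite -(ler_pM2l (expR_gt0 z)) -expRD subrr expR0.
have h0 := expR_ge1Dx z; have := expR_ge1Dx (z - 1); rewrite expRD => h1.
have : z * z <= z * (expR z * expR (-1)) by apply: ler_wpM2l; lra.
have : (1 - z) * (1 + z) <= (1 - z) * expR z by apply: ler_wpM2l; lra.
lra.
Qed.

(** The product is at most [expR (- s)]. For [s >= 1] this is at most [expR (- 1)]; for [s < 1] the
    chord bound applies. *)
Lemma prod_miss_le (I : finType) (z : I -> R) : (forall i, 0 <= z i <= 1) ->
  (1 - expR (- 1)) * Num.min 1 (\sum_i z i) <= 1 - \prod_i (1 - z i).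
Proof.
move=> z01; set s := \sum_i z i.
have : \prod_i (1 - z i) <= expR (- s).
  rewrite -sumrN expR_sum; apply: ler_prod => i _.
  by have /andP[_ zi1] := z01 i; rewrite subr_ge0 zi1 expR_ge1Dx.
have s0 : 0 <= s by apply: sumr_ge0 => i _; case/andP: (z01 i).
have [s1|s1] := leP 1 s.
  have : expR (- s) <= expR (- 1) by rewrite ler_expR lerN2.
  lra.
have := @expRN_chord s; rewrite s0 (ltW s1) => /(_ isT).
lra.
Qed.

End CorrelationGap.

(** * Upper bound on the adaptivity gap *)

Section UpperBound.
Variables (R : realType) (L Rt : finType) (E : {set L * Rt}) (p : L * Rt -> R).
Hypothesis pE : edge_probs E p.

Lemma coverage_indicator (S : {set (L + Rt)%type}) :
  coverage (activation E p) (fun x => (x \in S)%:R) = sigmaN E p S.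
Proof.
rewrite sigmaNE; apply: eq_bigr => y _; congr (_ - _).
rewrite [RHS]big_mkcond; apply: eq_bigr => x _.
by case: ifP; rewrite ?mul1r // mul0r subr0.
Qed.

Lemma sigmaN_le_OPT_N k (S : {set (L + Rt)%type}) :
  (#|S| <= k)%N -> sigmaN E p S <= OPT_N E p k.
Proof. by move=> Sk; apply: le_bigmax_cond. Qed.

Lemma sigmaA_le_OPT_N pi k : policies_k E k pi ->
  (1 - expR (- 1)) * sigmaA E p pi <= OPT_N E p k.
Proof.
move=> pik; have c0 : 0 <= 1 - expR (- 1) :> R.
  by rewrite subr_ge0 -[leRHS]expR0 ler_expR oppr_le0 ler01.
apply: le_trans (ler_wpM2l c0 (sigmaA_le pE pi)) _.
have q01 : unit_valued (seed_prob E p pi) by move=> x; apply: seed_prob01.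
have [S [Sk covS]] :=
  pipage_rounding (activation01 pE) q01 (sum_seed_prob_le pE pik).
apply: le_trans (sigmaN_le_OPT_N Sk); rewrite -coverage_indicator.
apply: le_trans covS; rewrite mulr_sumr; apply: ler_sum => y _.
apply: prod_miss_le => x; have /andP[q0 q1] := q01 x.
by have /andP[a0 a1] := activation01 pE x y; rewrite mulr_ge0 ?mulr_ile1.
Qed.

Lemma OPT_N_gt0 k : (0 < #|{: (L + Rt)%type}|)%N -> (1 <= k)%N ->
  0 < OPT_N E p k.
Proof.
move=> /card_gt0P[x _] k1; apply: lt_le_trans (_ : sigmaN E p [set x] <= _).
  rewrite sigmaNE (bigD1 x) //= big_set1.
  have -> : activation E p x x = 1 by case: x => x /=; rewrite eqxx.
  rewrite subrr subr0 ltr_pwDl // sumr_ge0 // => y _; rewrite big_set1.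
  by rewrite opprB addrC subrK; case/andP: (activation01 pE x y).
by apply: sigmaN_le_OPT_N; rewrite cards1.
Qed.

Let values k := [set sigmaA E p pi | pi in policies_k E k]%classic.

(** Ensures that [OPT_A] is a true supremum and not a default value: the policy that selects nothing
    gives a member, the bound by [OPT_N] gives boundedness. *)
Lemma OPT_A_has_sup k : has_sup (values k).
Proof.
split.
  exists (sigmaA E p (fun=> None)), (fun=> None) => // phi _.
  rewrite (_ : seeds _ _ _ = finset.set0) ?cards0 //; apply/setP => x; rewrite [RHS]inE.
  by apply/mem_seeds => -[n]; suff -> : run E (fun=> None) phi n = [::] by []; elim: n => //= n ->.
exists (OPT_N E p k / (1 - expR (- 1))) => _ [pi pik <-].
rewrite ler_pdivlMr 1?mulrC ?sigmaA_le_OPT_N //.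
by rewrite subr_gt0 -[ltRHS]expR0 ltr_expR oppr_lt0.
Qed.

Lemma sigmaA_le_OPT_A pi k : policies_k E k pi -> sigmaA E p pi <= OPT_A E p k.
Proof.
by move=> pik; apply: ub_le_sup; [case: (OPT_A_has_sup k)|exists pi].
Qed.

Lemma OPT_A_le k : OPT_A E p k <= OPT_N E p k / (1 - expR (- 1)).
Proof.
apply: ge_sup; first by case: (OPT_A_has_sup k).
move=> _ [pi pik <-]; rewrite ler_pdivlMr 1?mulrC ?sigmaA_le_OPT_N //.
by rewrite subr_gt0 -[ltRHS]expR0 ltr_expR oppr_lt0.
Qed.

End UpperBound.

(** * Tight instances: adaptive and non-adaptive spread *)

Section TightInstance.
Variables (R : realType) (s' k' t : nat) (c : R).
Local Notation s := s'.+1.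
Local Notation k := k'.+1.
Hypothesis c01 : 0 <= c <= 1.

(* [t] groups of [s] targets; a source [(g, i)] points at target [g j] of every
   group [j], and comes in [k] copies [i] so that its coins can be tossed anew. *)
Definition source := ({ffun 'I_t -> 'I_s} * 'I_k)%type.
Definition target := ('I_t * 'I_s)%type.
Definition pointing_prob (e : source * target) : R :=
  if e.1.1 e.2.1 == e.2.2 then c else 0.

Local Notation edges := [set: source * target].
Local Notation w := (edge_weight edges pointing_prob).
Implicit Types (phi : {set source * target}) (i : nat) (j : 'I_t).

Lemma pointing_prob01 : edge_probs edges pointing_prob.
Proof. by move=> e _; rewrite /pointing_prob; case: ifP; rewrite ?lexx ?ler01. Qed.

Definition next_target (h : {ffun 'I_t -> nat}) : {ffun 'I_t -> 'I_s} :=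
  [ffun j => inord (minn (h j) s')].

(* The number of successes per group when step [i] uses a fresh copy of the
   source that points, in each group, at the first target not yet hit (or at the
   last one once all are hit, so that the counter stays a Bernoulli sum). *)
Fixpoint hits phi i : {ffun 'I_t -> nat} :=
  if i is i1.+1 then
    let h := hits phi i1 in
    [ffun j => h j + (((next_target h, inord i1), (j, next_target h j)) \in phi)]%N
  else [ffun=> 0%N].

Definition seed_at phi i : source := (next_target (hits phi i), inord i).

Lemma hitsS phi i j :
  hits phi i.+1 j
  = (hits phi i j + ((seed_at phi i, (j, (seed_at phi i).1 j)) \in phi))%N.
Proof. by rewrite /= ffunE. Qed.

(** The first [i] steps look only at out-edges of the first [i] seeds. This gives both the freshness
    of later coins and the computability of the counters from feedback. *)
Lemma eq_hits phi phi' i :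
    (forall a v, (a < i)%N ->
      ((seed_at phi a, v) \in phi) = ((seed_at phi a, v) \in phi')) ->
  hits phi i = hits phi' i.
Proof.
elim: i => // i IHi eq_phi.
have eqi : hits phi i = hits phi' i.
  by apply: IHi => a v ai; apply: eq_phi; rewrite ltnW.
apply/ffunP => j; rewrite !hitsS -eqi; congr (_ + nat_of_bool _)%N.
by rewrite /seed_at -eqi; apply: eq_phi.
Qed.

Lemma seed_at_neq phi a i : (a < i)%N -> (i < k)%N -> (seed_at phi a).2 != inord i.
Proof.
move=> ai ik; rewrite -val_eqE /= !inordK // ?(ltn_trans ai) //.
by rewrite ltn_eqF.
Qed.

Lemma hits_fresh phi e i : (i < k)%N -> e.1.2 = inord i ->
  hits (e |: phi) i = hits (phi :\ e) i.
Proof.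
move=> ik ei; apply: eq_hits => a v ai; rewrite !inE.
have -> // : ((seed_at (e |: phi) a, v) == e) = false.
apply/eqP => eqe; have := seed_at_neq (e |: phi) ai ik.
by rewrite -ei -eqe eqxx.
Qed.

(** The source used at step [i] is random, so the expectation is split by its pointing function [g].
    For fixed [g] the coin is one fixed edge of copy [i], not seen by the earlier steps. *)
Lemma expect_hitsS i j (F : nat -> R) : (i < k)%N ->
  expect w (fun phi => F (hits phi i.+1 j))
  = c * expect w (fun phi => F (hits phi i j).+1)
    + (1 - c) * expect w (fun phi => F (hits phi i j)).
Proof.
move=> ik.
pose at_g g phi : R := (next_target (hits phi i) == g)%:R.
have splitE (f : {set source * target} -> R) :
    expect w f = \sum_g expect w (fun phi => at_g g phi * f phi).
  rewrite -expect_sum; apply: eq_expect => phi.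
  rewrite -mulr_suml (bigD1 (next_target (hits phi i))) //= /at_g eqxx big1.
    by rewrite addr0 mul1r.
  by move=> g; rewrite eq_sym => /negPf->.
rewrite !splitE !mulr_sumr -big_split; apply: eq_bigr => g _ /=.
pose e : source * target := ((g, inord i), (j, g j)).
have we : w e = c by rewrite /edge_weight inE /pointing_prob eqxx.
rewrite mulrBl mul1r addrCA -mulrBr -we -[X in _ * (_ - X)]mul1r -mulNr.
rewrite -expectZ -expectD -expect_mem; last first.
  by move=> phi; rewrite /at_g hits_fresh.
rewrite -expectD; apply: eq_expect => phi; rewrite hitsS /at_g /seed_at /=.
case: eqP => [->|]; last by rewrite !mul0r mulr0 addr0 mul0r addr0.
by rewrite -/e; case: (e \in phi); rewrite /= ?addn1 ?addn0 ?mulr0n !mulr1n; ring.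
Qed.

(** Squared bias plus variance of a binomial variable with parameters [i] and [c]. The centre [B] is
    arbitrary because a success shifts it to [B - 1] in the induction. *)
Lemma expect_sqr_hits i j (B : R) : (i <= k)%N ->
  expect w (fun phi => (B - (hits phi i j)%:R) ^+ 2)
  = (B - c * i%:R) ^+ 2 + c * (1 - c) * i%:R.
Proof.
elim: i B => [|i IHi] B ik.
  rewrite (eq_expect _ (g := fun=> B ^+ 2)) ?expect_cst.
    by rewrite !mulr0 subr0 addr0.
  by move=> phi; rewrite ffunE subr0.
rewrite (expect_hitsS _ (fun x => (B - x%:R) ^+ 2)) // IHi 1?ltnW //.
rewrite (eq_expect _ (g := fun phi => (B - 1 - (hits phi i j)%:R) ^+ 2)).
  by rewrite IHi 1?ltnW // -[i.+1]addn1 natrD; ring.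
by move=> phi; rewrite -addn1 natrD opprD addrA addrAC.
Qed.

(** A parabola below the truncation, touching it at [s - l] and at its apex [s + l]; second moments
    then suffice to bound the truncated mean. *)
Lemma minn_ge_quadratic (x : nat) (l : R) : 0 < l ->
  s%:R - (s%:R + l - x%:R) ^+ 2 / (4 * l) <= (minn x s)%:R.
Proof.
move=> l0; have [xs|sx] := leqP x s; last first.
  by rewrite gerBl divr_ge0 ?sqr_ge0 // mulr_ge0 // ltW.
rewrite lerBlDr -lerBlDl ler_pdivlMr ?mulr_gt0 //.
have := sqr_ge0 (s%:R - x%:R - l); rewrite -subr_ge0 => h.
by rewrite -subr_ge0; apply: le_trans h _; rewrite le_eqVlt; apply/orP; left; apply/eqP; ring.
Qed.

(** The condition [c * k = s] centres the counter at [s], and its variance [s * (1 - c)] is at most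
    [s]. *)
Lemma expect_minn_hits j (l : R) : 0 < l -> c * k%:R = s%:R ->
  s%:R - (l ^+ 2 + s%:R) / (4 * l)
  <= expect w (fun phi => (minn (hits phi k j) s)%:R).
Proof.
move=> l0 ck; have /andP[c0 c1] := c01.
apply: le_trans (_ : expect w (fun phi =>
   s%:R + - (4 * l)^-1 * (s%:R + l - (hits phi k j)%:R) ^+ 2) <= _).
  rewrite expectD expect_cst expectZ expect_sqr_hits // ck mulNr lerD2l lerN2.
  rewrite mulrC ler_pM2r ?invr_gt0 ?mulr_gt0 //.
  rewrite addrAC subrr add0r lerD2l -mulrA mulrCA ck ler_piMl // gerBl //.
apply: ler_expect => [e|phi _]; first exact/edge_weight01/pointing_prob01.
by rewrite mulNr mulrC minn_ge_quadratic.
Qed.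

(** A policy sees only its history, so the counters are computed on [phi_h], the set of observed
    live edges. It agrees with the realization on the out-edges of past seeds. *)
Definition next_source : policy source target := fun h =>
  if (size h < k)%N then
    let phi_h := [set e | has (fun r : node source target * (_ * {set _}) => e \in r.2.2) h] in
    Some (inl (seed_at phi_h (size h)))
  else None.

Lemma run_next_source phi i : (i <= k)%N ->
  run edges next_source phi i
  = [seq (inl (seed_at phi a), feedback edges (inl (seed_at phi a)) phi)
    | a <- iota 0 i].
Proof.
elim: i => // i IHi ik; rewrite [LHS]/= IHi 1?ltnW // /next_source size_map size_iota ik.
set phi_h := finset _.
suff -> : seed_at phi_h i = seed_at phi i.
  by rewrite -[i.+1]addn1 iotaD map_cat cats1.
rewrite /seed_at -(@eq_hits phi phi_h i) // => a v ai.
rewrite [RHS]inE has_map; apply/idP/hasP => [av|[b _]] /=; last first.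
  by move=> /setIP[].
exists a; first by rewrite mem_iota.
rewrite -[_ \in _]/((seed_at phi a, v) \in (feedback edges (inl (seed_at phi a)) phi).2).
by rewrite feedbackE !inE av !eqxx.
Qed.

Lemma run_next_source_stop phi i : (k <= i)%N ->
  run edges next_source phi i = run edges next_source phi k.
Proof.
move=> /subnK <-; elim: (i - k)%N => // m IHm; rewrite addSn [LHS]/= IHm.
by rewrite {1}/next_source run_next_source // size_map size_iota ltnn.
Qed.

Lemma mem_seeds_next_source phi x :
  x \in seeds edges next_source phi <->
  exists2 a, (a < k)%N & x = inl (seed_at phi a).
Proof.
split=> [/mem_seeds[i]|[a ak ->]].
  have [ik|ki] := leqP i k; last rewrite run_next_source_stop 1?ltnW //;
    rewrite run_next_source // -map_comp => /mapP[a]; rewrite mem_iota /= => ai ->;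
    exists a => //; exact: leq_trans ai _.
apply/mem_seeds; exists k; rewrite run_next_source // -map_comp.
by apply/mapP; exists a; rewrite ?mem_iota.
Qed.

Lemma next_source_policy : policies_k edges k next_source.
Proof.
move=> phi _; rewrite -[leqRHS](size_iota 0).
rewrite -(size_map (fun a => inl (seed_at phi a) : (source + target)%type)).
apply: leq_trans (card_size _); apply: subset_leq_card.
apply/fintype.subsetP => x /mem_seeds_next_source[a ak ->].
by apply/mapP; exists a; rewrite ?mem_iota.
Qed.

(** The counter passes from [b] to [b + 1] only through a live edge to target [b], so the targets
    below it have all been hit. *)
Lemma hits_live phi i j (b : 'I_s) : (b < hits phi i j)%N ->
  exists2 a, (a < i)%N & (seed_at phi a, (j, b)) \in phi.
Proof.
elim: i => [|i IHi]; first by rewrite ffunE.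
have [bi _|ib] := ltnP b (hits phi i j).
  by have [a ai aphi] := IHi bi; exists a => //; apply: ltnW.
rewrite hitsS; case: (boolP (_ \in phi)) => [live_i bi|_]; last first.
  by rewrite addn0 ltnNge ib.
exists i => //; suff -> : b = (seed_at phi i).1 j by [].
have eqb : (b : nat) = hits phi i j.
  by apply/eqP; rewrite eqn_leq ib andbT; move: bi; rewrite addn1 ltnS.
apply: val_inj; rewrite /= ffunE -eqb inordK ?ltnS ?geq_minr //.
by apply/esym/minn_idPl; rewrite -ltnS.
Qed.

Lemma sum_ltn_minn (h m : nat) : (\sum_(b < m) (b < h) = minn h m)%N.
Proof.
elim: m => [|m IHm]; first by rewrite big_ord0 minn0.
rewrite big_ord_recr /= IHm; case: (ltnP m h) => mh.
  by rewrite (minn_idPr mh) addn1.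
by rewrite addn0 (minn_idPl (leqW mh)).
Qed.

Lemma card_reach_next_source phi :
  (\sum_j minn (hits phi k j) s
   <= #|reach (seeds edges next_source phi) phi|)%N.
Proof.
pose hit_set := [set v : target | (v.2 < hits phi k v.1)%N].
apply: leq_trans (_ : #|[set (inr v : (source + target)%type) | v in hit_set]| <= _)%N.
  rewrite card_imset; last by move=> v v' [].
  rewrite -sum1_card [X in (_ <= X)%N]big_mkcond.
  rewrite [X in (_ <= X)%N](eq_bigr (fun v : target => nat_of_bool (v.2 < hits phi k v.1)%N)).
    under eq_bigr do rewrite -sum_ltn_minn.
    by rewrite pair_bigA.
  by move=> v _; rewrite inE; case: ltnP.
apply/subset_leq_card/fintype.subsetP => _ /imsetP[[j b] + ->].
rewrite inE => /(@hits_live phi k j b)[a ak live_a]; rewrite mem_reach.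
apply/existsP; exists (inl (seed_at phi a)); rewrite /hit /= live_a andbT.
by apply/mem_seeds_next_source; exists a.
Qed.

Lemma sigmaA_next_source (l : R) : 0 < l -> c * k%:R = s%:R ->
  t%:R * (s%:R - (l ^+ 2 + s%:R) / (4 * l))
  <= sigmaA edges pointing_prob next_source.
Proof.
move=> l0 ck; rewrite /sigmaA sum_realization.
apply: le_trans (_ : expect w (fun phi =>
  \sum_j (minn (hits phi k j) s)%:R) <= _); last first.
  apply: ler_expect => [e|phi _]; first exact/edge_weight01/pointing_prob01.
  by rewrite -natr_sum ler_nat card_reach_next_source.
rewrite expect_sum mulrC mulr_natr -[X in _ *+ X]card_ord -sumr_const.
by apply: ler_sum => j _; apply: expect_minn_hits.
Qed.

(** By convexity in [d], the power lies above the line through its values at [n] and [n + 1].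
    Bernoulli's inequality proves it on either side of [n]. *)
Lemma exp_ge_tangent (d n : nat) :
  (1 - c) ^+ n * (1 - c * (d%:R - n%:R)) <= (1 - c) ^+ d.
Proof.
have /andP[c0 c1] := c01; have c10 : 0 <= 1 - c by rewrite subr_ge0.
have bern_ineq (x : R) m : -1 <= x -> 1 + m%:R * x <= (1 + x) ^+ m.
  move=> x1; elim: m => [|m IHm]; first by rewrite mul0r addr0 expr0.
  rewrite exprS; apply: le_trans (ler_wpM2l _ IHm); last by lra.
  have : 0 <= m%:R * x ^+ 2 by rewrite mulr_ge0 ?sqr_ge0.
  rewrite -[m.+1]addn1 natrD; lra.
have [nd|dn] := leqP n d.
  rewrite -(subnKC nd) exprD ler_wpM2l ?exprn_ge0 // natrD addrAC subrr add0r.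
  have := bern_ineq (- c) (d - n)%N; rewrite lerN2 => /(_ c1).
  by rewrite mulrN mulrC.
rewrite -{1 2}(subnKC (ltnW dn)) exprD -mulrA -[leRHS]mulr1.
rewrite ler_wpM2l ?exprn_ge0 // natrD opprD addrA subrr add0r mulrN opprK.
apply: le_trans (_ : (1 - c) ^+ (n - d) * (1 + c) ^+ (n - d) <= _).
  rewrite ler_wpM2l ?exprn_ge0 // mulrC bern_ineq //; lra.
rewrite -exprMn exprn_ile1 //; last by nra.
by rewrite mulr_ge0 // addr_ge0.
Qed.

Lemma sigmaN_le_tight (n : nat) (S : {set (source + target)%type}) :
  (#|S| <= k)%N -> (k = s * n)%N ->
  sigmaN edges pointing_prob S
  <= k%:R + t%:R * (s%:R * (1 - (1 - c) ^+ n)).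
Proof.
move=> Sk ksn; have /andP[c0 c1] := c01.
have c10 : 0 <= 1 - c by rewrite subr_ge0.
pose act := activation edges pointing_prob.
pose SL : {set source} := [set u | inl u \in S].
have SLk : (#|SL| <= k)%N.
  apply: leq_trans Sk.
  rewrite -(card_imset _ (_ : injective (inl : source -> source + target)%type));
    last by move=> u u' [].
  by apply/subset_leq_card/fintype.subsetP => _ /imsetP[u + ->]; rewrite inE.
pose d j b := #|[set u in SL | u.1 j == b]|.
have sum_d j : \sum_b (d j b)%:R = #|SL|%:R :> R.
  rewrite -natr_sum; congr (_%:R).
  rewrite -[RHS]sum1_card [RHS](partition_big (fun u : source => u.1 j) xpredT) //=.
  by apply: eq_bigr => b _; rewrite sum1dep_card /d; apply: eq_card => u; rewrite !inE.
have miss_target j b : inr (j, b) \notin S ->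
    \prod_(x in S) (1 - act x (inr (j, b))) = (1 - c) ^+ d j b.
  move=> jbS; rewrite big_mkcond big_sumType /= [X in _ * X]big1 ?mulr1; last first.
    move=> v _; case: ifP => // vS; rewrite (_ : (_ == _) = false) ?subr0 //.
    by apply: contraNF jbS => /eqP <-.
  rewrite -[d j b]sum1_card -prodrXr big_mkcond [RHS]big_mkcond.
  apply: eq_bigr => u _; rewrite !inE.
  case: ifP => //= _; rewrite /edge_weight inE /pointing_prob /=.
  by case: ifP; rewrite ?subr0 ?expr1.
rewrite sigmaNE big_sumType /=.
(* Each seed is charged 1 for itself, which covers targets chosen as seeds; a target aimed at by [d]
   chosen sources is missed with probability [(1 - c) ^+ d]. *)
apply: le_trans (_ : \sum_x (x \in S)%:R
  + \sum_(v : target) (1 - (1 - c) ^+ d v.1 v.2) <= _).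
  rewrite big_sumType /= -addrA -big_split /=; apply: lerD; apply: ler_sum.
    move=> u _; case: (boolP (inl u \in S)) => uS.
      by rewrite (bigD1 (inl u)) //= eqxx subrr mul0r subr0.
    rewrite big1 ?subrr // => x xS; rewrite (_ : activation _ _ _ _ = 0) ?subr0 //.
    case: x xS => [u'|v] //= u'S; case: eqP => // u'u.
    by rewrite -u'u u'S in uS.
  move=> [j b] _ /=; case: (boolP (inr (j, b) \in S)) => jbS.
    rewrite (bigD1 (inr (j, b))) //= eqxx subrr mul0r subr0 lerDl subr_ge0.
    by rewrite exprn_ile1 // gerBl.
  by rewrite miss_target // add0r.
apply: lerD.
  rewrite -natr_sum ler_nat; apply: leq_trans Sk.
  by rewrite -sum1_card [X in (_ <= X)%N]big_mkcond; apply: leq_sum => x _; case: ifP.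
rewrite -(pair_bigA _ (fun j b => 1 - (1 - c) ^+ d j b)) /=.
rewrite mulrC mulr_natr -[X in _ *+ X]card_ord -sumr_const.
apply: ler_sum => j _.
apply: le_trans (_ : \sum_b (1 - (1 - c) ^+ n * (1 - c * ((d j b)%:R - n%:R))) <= _).
  by apply: ler_sum => b _; rewrite lerD2l lerN2 exp_ge_tangent.
rewrite sumrB -mulr_sumr sumrB -mulr_sumr sumrB sum_d !sumr_const !card_ord.
(* Within a group the deviations [d j b - n] sum to [#|SL| - k], which is at most 0, so the linear
   terms do not increase the bound. *)
have : 0 <= c * (k%:R - #|SL|%:R) by rewrite mulr_ge0 // subr_ge0 ler_nat.
have -> : k%:R = s%:R * n%:R :> R by rewrite ksn natrM.
move=> h; rewrite -[n%:R *+ _]mulr_natr [leRHS]mulrBr mulr1 lerD2l lerN2 mulrC.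
by rewrite ler_wpM2l ?exprn_ge0 //; lra.
Qed.

End TightInstance.

(** * Choice of parameters and the limit *)

Section Supremum.
Variable R : realType.

(** The base is the inverse of [1 + 1/(m+1)], which is at most [expR (1/(m+1))]. The exponent is one
    less than the denominator, as needed for a lower bound. *)
Lemma expRN1_le_exp (m : nat) :
  expR (- 1) <= (1 - m.+2%:R^-1) ^+ m.+1 :> R.
Proof.
have m1 : m.+1%:R != 0 :> R by rewrite pnatr_eq0.
have m2 : m.+2%:R != 0 :> R by rewrite pnatr_eq0.
have -> : - 1 = m.+1%:R * - m.+1%:R^-1 :> R by rewrite mulrN divff.
have e_le : expR (- m.+1%:R^-1) <= 1 - m.+2%:R^-1 :> R.
  have -> : 1 - m.+2%:R^-1 = (1 + m.+1%:R^-1)^-1 :> R.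
    have m12 : m.+2%:R = m.+1%:R + 1 :> R by rewrite -[m.+2]addn1 natrD.
    by move: m1 m2; rewrite m12; move: (m.+1%:R : R) => x x0 x1; field; rewrite ?x0 ?x1.
  by rewrite expRN lef_pV2 ?posrE ?expR_gt0 ?expR_ge1Dx // addr_gt0 // invr_gt0.
by rewrite expRM_natl lerXn2r ?nnegrE ?expR_ge0 // (le_trans _ e_le) ?expR_ge0.
Qed.

Lemma tight_ratio (m : nat) : let n : R := m.+2%:R in
  exists (L Rt : finType) (E : {set L * Rt}) (p : L * Rt -> R) (k : nat),
    [/\ edge_probs E p, (0 < #|{: (L + Rt)%type}|)%N, (1 <= k)%N
      & (1 - n^-1) / (1 - expR (- 1) + 2 * n^-1) <= OPT_A E p k / OPT_N E p k].
Proof.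
move=> n; set N := m.+2; have n0 : 0 < n by rewrite ltr0n.
have n_neq0 : n != 0 by rewrite gt_eqF.
pose s' := (N ^ 2).-1; pose k' := (N ^ 3).-1; pose t := (N ^ 2)%N.
have sE : s'.+1 = (N ^ 2)%N by rewrite prednK // expn_gt0.
have kE : k'.+1 = (N ^ 3)%N by rewrite prednK // expn_gt0.
have sR : s'.+1%:R = n ^+ 2 :> R by rewrite sE natrX.
have kR : k'.+1%:R = n ^+ 3 :> R by rewrite kE natrX.
have tR : t%:R = n ^+ 2 :> R by rewrite natrX.
have n_ge1 : 1 <= n by rewrite ler1n.
have := expRN1_le_exp m; rewrite -/n; clearbody n => exp_ge.
have c01 : 0 <= n^-1 <= 1 by rewrite invr_ge0 ltW //= invf_le1.
have ck : n^-1 * k'.+1%:R = s'.+1%:R.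
  by rewrite kR sR exprS mulrA mulVf // mul1r.
pose p : source s' k' t * target s' t -> R := pointing_prob n^-1.
have pE : edge_probs [set: source s' k' t * target s' t] p by exact: pointing_prob01.
exists (source s' k' t), (target s' t), [set: source s' k' t * target s' t], p, k'.+1.
have V0 : (0 < #|{: (source s' k' t + target s' t)%type}|)%N.
  by apply/card_gt0P; exists (inl ([ffun=> ord0], ord0)).
split => //.
have := sigmaA_le_OPT_A pE (@next_source_policy s' k' t).
(* Here [l = n], which minimizes the loss [(l^2 + n^2) / (4 l)] per group and makes it [n / 2]. *)
move/(le_trans (sigmaA_next_source t c01 n0 ck)); rewrite sR ?tR => lowA.
(* One [n^-1] pays for the [n ^+ 3] seeds themselves, the other for the factor [1 - n^-1] by which
   [(1 - n^-1) ^+ N] exceeds the exponent of [expRN1_le_exp]. *)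
have upN : OPT_N [set: source s' k' t * target s' t] p k'.+1
    <= n ^+ 4 * (1 - expR (- 1) + 2 * n^-1).
  apply/bigmax_leP; split => [|S Sk].
    rewrite mulr_ge0 ?exprn_ge0 ?(ltW n0) // addr_ge0 ?mulr_ge0 ?invr_ge0 ?(ltW n0) //.
    by rewrite subr_ge0 -[leRHS]expR0 ler_expR oppr_le0 ler01.
  apply: le_trans (sigmaN_le_tight c01 Sk (_ : _ = s'.+1 * N)%N) _.
    by rewrite kE sE -expnSr.
  rewrite kR sR ?tR [_ ^+ N]exprS.
  move: ((1 - n^-1) ^+ m.+1) exp_ge => x ex.
  have : (1 - n^-1) * expR (- 1) <= (1 - n^-1) * x.
    by rewrite ler_wpM2l // subr_ge0; case/andP: c01.
  have e1 : expR (- 1) <= 1 :> R by rewrite -[leRHS]expR0 ler_expR oppr_le0 ler01.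
  have : n^-1 * expR (- 1) <= n^-1 by rewrite ler_piMr // invr_ge0 ltW.
  move=> h1 h2.
  have -> : n ^+ 3 = n ^+ 4 * n^-1 by field.
  rewrite mulrA -exprD -mulrDr ler_wpM2l ?exprn_ge0 ?(ltW n0) //.
  lra.
have N0 := OPT_N_gt0 pE V0 (isT : (1 <= k'.+1)%N).
have D0 : 0 < 1 - expR (- 1) + 2 * n^-1 by rewrite -(pmulr_rgt0 _ (exprn_gt0 4 n0)) (lt_le_trans N0).
rewrite ler_pdivrMr // mulrAC ler_pdivlMr //.
apply: le_trans (_ : (1 - n^-1) * (n ^+ 4 * (1 - expR (- 1) + 2 * n^-1)) <= _).
  by rewrite ler_wpM2l // subr_ge0; case/andP: c01.
rewrite mulrA ler_pM2r //; apply: le_trans lowA.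
rewrite -subr_ge0.
rewrite (_ : _ - _ = n ^+ 3 / 2); last by field.
by rewrite divr_ge0 // exprn_ge0 // ltW.
Qed.

End Supremum.

Local Open Scope classical_set_scope.

Theorem theorem3 (R : realType) :
  sup [set r : R | exists (L Rt : finType) (E : {set L * Rt}) (p : L * Rt -> R)
                          (k : nat),
         [/\ edge_probs E p, (0 < #|{: (L + Rt)%type}|)%N, (1 <= k)%N
           & r = OPT_A E p k / OPT_N E p k]]
  = expR 1 / (expR 1 - 1).
Proof.
set ratios := [set r : R | _].
have d0 : 0 < 1 - expR (- 1) :> R.
  by rewrite subr_gt0 -[ltRHS]expR0 ltr_expR oppr_lt0.
have -> : expR 1 / (expR 1 - 1) = (1 - expR (- 1))^-1 :> R.
  have e0 : expR 1 != 0 :> R by rewrite gt_eqF ?expR_gt0.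
  have -> : expR 1 - 1 = expR 1 * (1 - expR (- 1)) :> R.
    by rewrite mulrBr mulr1 -expRD subrr expR0.
  by rewrite invfM mulrA divff // mul1r.
have ub : ubound ratios (1 - expR (- 1))^-1.
  move=> _ [L [Rt [E [p [k [pE V0 k1 ->]]]]]].
  by rewrite ler_pdivrMr ?(OPT_N_gt0 pE) // mulrC OPT_A_le.
have ge_ratio m : (1 - m.+2%:R^-1) / (1 - expR (- 1) + 2 * m.+2%:R^-1) <= sup ratios.
  have [L [Rt [E [p [k [pE V0 k1 ratio]]]]]] := tight_ratio R m.
  apply: le_trans ratio _; apply: ub_le_sup; first by exists (1 - expR (- 1))^-1.
  by exists L, Rt, E, p, k.
apply/eqP; rewrite eq_le; apply/andP; split.
  apply: ge_sup ub; have [L [Rt [E [p [k [pE V0 k1 _]]]]]] := tight_ratio R 0.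
  by exists (OPT_A E p k / OPT_N E p k), L, Rt, E, p, k.
set S := sup ratios in ge_ratio *.
have S0 : 0 <= S.
  apply: le_trans (ge_ratio 0%N); rewrite divr_ge0 //.
    by rewrite subr_ge0 invf_le1 ?ltr0n // ler1n.
  by rewrite addr_ge0 ?(ltW d0) // mulr_ge0 ?invr_ge0.
rewrite -[leLHS]mul1r ler_pdivrMr // leNgt; apply/negP => gap.
have gap0 : 0 < 1 - S * (1 - expR (- 1)) by rewrite subr_gt0.
(* With [n = m + 2], [ge_ratio] amounts to [n * (1 - S * (1 - expR (- 1))) <= 2 * S + 1]; this [m]
   is large enough to contradict it. *)
pose m := Num.bound ((2 * S + 1) / (1 - S * (1 - expR (- 1)))).
have : (2 * S + 1) / (1 - S * (1 - expR (- 1))) < m%:R.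
  by apply: archi_boundP; rewrite divr_ge0 ?(ltW gap0) // addr_ge0 ?mulr_ge0.
rewrite ltr_pdivrMr // => mS.
have n0 : 0 < m.+2%:R :> R by rewrite ltr0n.
have := ge_ratio m; rewrite ler_pdivrMr; last first.
  by rewrite addr_gt0 // mulr_gt0 ?invr_gt0.
rewrite -(ler_pM2l n0).
have -> : m.+2%:R * (1 - m.+2%:R^-1) = m.+2%:R - 1 :> R.
  by rewrite mulrBr mulr1 divff ?gt_eqF.
rewrite mulrCA mulrDr [m.+2%:R * (2 * _)]mulrCA divff ?gt_eqF // -[m.+2]addn2 natrD.
lra.
Qed.
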